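(* Let $\boldsymbol{\mu}=(\mu_1,\ldots,\mu_n)$ be an $n$-tuple of umbral monomials with generating function $f(\boldsymbol{\mu},\boldsymbol{t}_{(n)})$ and let $\{\boldsymbol{\nu}_1,\ldots,\boldsymbol{\nu}_n\}$ be a set of $m$-tuples of umbral monomials with generating functions $f(\boldsymbol{\nu}_i,\boldsymbol{t}_{(m)})$, $i=1,\dots,n$, where $\boldsymbol{t}_{(k)}=(t_1,\dots,t_k)$. Then the auxiliary umbra $\mu_1\boldsymbol{.}\beta\boldsymbol{.}\boldsymbol{\nu}_1+\cdots+\mu_n\boldsymbol{.}\beta\boldsymbol{.}\boldsymbol{\nu}_n$ has generating function $$f[\mu_1\boldsymbol{.}\beta\boldsymbol{.}\boldsymbol{\nu}_1+\cdots+\mu_n\boldsymbol{.}\beta\boldsymbol{.}\boldsymbol{\nu}_n,\,\boldsymbol{t}_{(m)}]=f[\boldsymbol{\mu},(f(\boldsymbol{\nu}_1,\boldsymbol{t}_{(m)})-1,\ldots,f(\boldsymbol{\nu}_n,\boldsymbol{t}_{(m)})-1)],$$ an identity of formal power series in $t_1,\dots,t_m$.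
   Context: $R$ is the real or complex field, $A$ is a set (the alphabet) whose elements are called umbrae, and $E:R[A]\to R$ is a linear functional (evaluation) with $E[1]=1$ and $E[\alpha^i\gamma^j\cdots]=E[\alpha^i]E[\gamma^j]\cdots$ for distinct umbrae and nonnegative integers $i,j,\dots$. A $k$-tuple $\boldsymbol{\mu}=(\mu_1,\dots,\mu_k)$ of umbral monomials (monomials in $R[A]$, supports not necessarily disjoint) has multivariate moments $E[\boldsymbol{\mu}^{\boldsymbol{i}}]$, $\boldsymbol{\mu}^{\boldsymbol{i}}=\mu_1^{i_1}\cdots\mu_k^{i_k}$, $\boldsymbol{i}\in\mathbb{N}_0^k$, and generating function $f(\boldsymbol{\mu},\boldsymbol{t}_{(k)})=1+\sum_{\boldsymbol{i}\neq\boldsymbol{0}}E[\boldsymbol{\mu}^{\boldsymbol{i}}]\,\boldsymbol{t}_{(k)}^{\boldsymbol{i}}/\boldsymbol{i}!$ with $\boldsymbol{i}!=i_1!\cdots i_k!$, $\boldsymbol{t}_{(k)}^{\boldsymbol{i}}=t_1^{i_1}\cdots t_k^{i_k}$. For formal power series $s_1,\dots,s_n$ without constant term, $f[\boldsymbol{\mu},(s_1,\dots,s_n)]$ denotes the substitution $t_j\mapsto s_j$ in $f(\boldsymbol{\mu},\boldsymbol{t}_{(n)})$. Partitions of a multi-index: a partition $\boldsymbol{\lambda}$ of $\boldsymbol{i}\in\mathbb{N}_0^m$, written $\boldsymbol{\lambda}\vdash\boldsymbol{i}$, is a matrix of nonnegative integers with $m$ rows, no zero column, columns in lexicographic order, and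 $r$-th row sum equal to $i_r$ for $r=1,\dots,m$ (for $\boldsymbol{i}=\boldsymbol{0}$ the only partition is the empty one). Its number of columns is $l(\boldsymbol{\lambda})$. Writing $\boldsymbol{\lambda}=(\boldsymbol{\lambda}_1^{r_1},\boldsymbol{\lambda}_2^{r_2},\dots)$ when the distinct column $\boldsymbol{\lambda}_j$ occurs $r_j$ times, set $\mathfrak{m}(\boldsymbol{\lambda})!=r_1!r_2!\cdots$ and $\boldsymbol{\lambda}!=\prod_j(\boldsymbol{\lambda}_j!)^{r_j}$ (product of factorials of all entries). With $h^{(j)}_{\boldsymbol{k}}=E[\boldsymbol{\nu}_j^{\boldsymbol{k}}]$ set $h^{(j)}_{\boldsymbol{\lambda}}=(h^{(j)}_{\boldsymbol{\lambda}_1})^{r_1}(h^{(j)}_{\boldsymbol{\lambda}_2})^{r_2}\cdots$. The auxiliary umbra $\mu_1\boldsymbol{.}\beta\boldsymbol{.}\boldsymbol{\nu}_1+\cdots+\mu_n\boldsymbol{.}\beta\boldsymbol{.}\boldsymbol{\nu}_n$ ($\beta$ denotes the Bell umbra) is a symbolic $m$-tuple. Its moments are computed by first treating $\mu_1,\dots,\mu_n$ as constants (indeterminates), with the $n$ summands mutually uncorrelated and $$(\mu_j\boldsymbol{.}\beta\boldsymbol{.}\boldsymbol{\nu}_j)^{\boldsymbol{k}}\ \text{evaluated to}\ \sum_{\boldsymbol{\lambda}\vdash\boldsymbol{k}}\frac{\boldsymbol{k}!}{\mathfrak{m}(\boldsymbol{\lambda})!\,\boldsymbol{\lambda}!}\,\mu_j^{l(\boldsymbol{\lambda})}\,h^{(j)}_{\boldsymbol{\lambda}},$$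 and then applying $E$ to the resulting polynomial in $\mu_1,\dots,\mu_n$. Explicitly, for $\boldsymbol{i}\in\mathbb{N}_0^m$, the $\boldsymbol{i}$-th moment is $$\sum_{\boldsymbol{k}_1+\cdots+\boldsymbol{k}_n=\boldsymbol{i}}\frac{\boldsymbol{i}!}{\boldsymbol{k}_1!\cdots\boldsymbol{k}_n!}\sum_{\boldsymbol{\lambda}^{(1)}\vdash\boldsymbol{k}_1,\dots,\boldsymbol{\lambda}^{(n)}\vdash\boldsymbol{k}_n}\Big(\prod_{j=1}^n\frac{\boldsymbol{k}_j!}{\mathfrak{m}(\boldsymbol{\lambda}^{(j)})!\,\boldsymbol{\lambda}^{(j)}!}h^{(j)}_{\boldsymbol{\lambda}^{(j)}}\Big)E\big[\mu_1^{l(\boldsymbol{\lambda}^{(1)})}\cdots\mu_n^{l(\boldsymbol{\lambda}^{(n)})}\big].$$ Its generating function is the exponential generating function of these moments in $\boldsymbol{t}_{(m)}$. *)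

(* Defs.v *)
(* 'X_{1..m} is the type of multi-indices of length m
   (mpoly.v), {malg K[{cmonom A}]} is the polynomial ring K[A] over an arbitrary
   choiceType A of indeterminates (monalg.v). *)
From HB Require Import structures.
From mathcomp Require Import all_boot all_order all_algebra.
From mathcomp Require Import finmap monalg mpoly complex reals.

Set Implicit Arguments.
Unset Strict Implicit.
Unset Printing Implicit Defensive.

Import Order.TTheory GRing.Theory Num.Theory.

Local Open Scope ring_scope.

Definition real_or_complex (K : numFieldType) : Prop :=
  exists R : realType, K = R :> numFieldType \/ K = R[i] :> numFieldType.

Notation upoly K A := {malg K[{cmonom A}]}.

Definition umbra (K : numFieldType) (A : choiceType) (a : A) : upoly K A :=
  << ucm a >>.

Definition umbral_monomial (K : numFieldType) (A : choiceType) (p : upoly K A) :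
  Prop := exists M : {cmonom A}, p = << M >>.

Definition uncorrelated (K : numFieldType) (A : choiceType)
    (E : {scalar upoly K A}) : Prop :=
  forall (s : seq A) (e : A -> nat), uniq s ->
    E (\prod_(a <- s) umbra K a ^+ e a) = \prod_(a <- s) E (umbra K a ^+ e a).

Definition is_evaluation (K : numFieldType) (A : choiceType)
    (E : {scalar upoly K A}) : Prop :=
  E 1 = 1 /\ uncorrelated E.

Definition mfact (m : nat) (i : 'X_{1..m}) : nat := (\prod_(r < m) (i r)`!)%N.

Definition tuple_exp (K : numFieldType) (A : choiceType) (k : nat)
    (mu : 'I_k -> upoly K A) (i : 'X_{1..k}) : upoly K A :=
  \prod_(j < k) mu j ^+ i j.

Definition moment (K : numFieldType) (A : choiceType)
    (E : {scalar upoly K A}) (k : nat) (mu : 'I_k -> upoly K A)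
    (i : 'X_{1..k}) : K :=
  E (tuple_exp mu i).

(* A formal power series in t_1, ..., t_m is its family of coefficients. *)
Definition fps (K : numFieldType) (m : nat) := 'X_{1..m} -> K.

Definition fps_one (K : numFieldType) (m : nat) : fps K m :=
  fun i => (i == 0%MM)%:R.

Definition fps_sub (K : numFieldType) (m : nat) (s t : fps K m) : fps K m :=
  fun i => s i - t i.

Definition fps_mul (K : numFieldType) (m : nat) (s t : fps K m) : fps K m :=
  fun i => \sum_(k : 'X_{1..m < (mdeg i).+1, (mdeg i).+1} |
                 (k.1 + k.2)%MM == i) s k.1 * t k.2.

Definition fps_exp (K : numFieldType) (m : nat) (s : fps K m) (e : nat) :
  fps K m := iter e (fps_mul s) (@fps_one K m).

Definition fps_tuple_exp (K : numFieldType) (n m : nat) (s : 'I_n -> fps K m)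
    (k : 'X_{1..n}) : fps K m :=
  \big[@fps_mul K m/@fps_one K m]_(j < n) fps_exp (s j) (k j).

(* Substitution t_j := s_j, meaningful when no s_j has a constant term: the
   coefficient of t^i in s^k then vanishes for |k| > |i| (fps_tuple_exp_eq0),
   so the sum over all k reduces to |k| <= |i|. *)
Definition fps_subst (K : numFieldType) (n m : nat) (f : fps K n)
    (s : 'I_n -> fps K m) : fps K m :=
  fun i => \sum_(k : 'X_{1..n < (mdeg i).+1}) f k * fps_tuple_exp s k i.

Definition gf (K : numFieldType) (A : choiceType)
    (E : {scalar upoly K A}) (k : nat) (mu : 'I_k -> upoly K A) :
  fps K k :=
  fun i => if i == 0%MM then 1 else moment E mu i / (mfact i)%:R.

(* The order on multi-indices provided by mpoly.v compares degrees first. *)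
Definition mlex_le (m : nat) : rel 'X_{1..m} :=
  fun a b => ((val a : m.-tuplelexi nat) <= (val b : m.-tuplelexi nat))%O.

(* A matrix with m rows is given by the list of its columns. *)
Definition is_partition (m : nat) (i : 'X_{1..m}) (L : seq 'X_{1..m}) : bool :=
  [&& 0%MM \notin L, sorted (@mlex_le m) L & (\sum_(c <- L) c)%MM == i].

(* A partition of i has at most |i| columns, each of degree at most |i|. *)
Definition partitions (m : nat) (i : 'X_{1..m}) : seq (seq 'X_{1..m}) :=
  [seq L <- [seq map val (val B)
            | B <- enum {: (mdeg i).-bseq 'X_{1..m < (mdeg i).+1}}]
  | is_partition i L].

Definition part_mult_fact (m : nat) (L : seq 'X_{1..m}) : nat :=
  (\prod_(c <- undup L) (count_mem c L)`!)%N.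

Definition part_fact (m : nat) (L : seq 'X_{1..m}) : nat :=
  (\prod_(c <- undup L) mfact c ^ count_mem c L)%N.

Definition part_moment (K : numFieldType) (m : nat) (h : 'X_{1..m} -> K)
    (L : seq 'X_{1..m}) : K :=
  \prod_(c <- undup L) h c ^+ count_mem c L.

(* (mu . beta . nu)^k with mu kept as an element of K[A]. *)
Definition bell_dot_power (K : numFieldType) (A : choiceType)
    (E : {scalar upoly K A}) (m : nat) (mu : upoly K A)
    (nu : 'I_m -> upoly K A) (k : 'X_{1..m}) : upoly K A :=
  \sum_(L <- partitions k)
    ((mfact k)%:R / (part_mult_fact L * part_fact L)%:R
       * part_moment (moment E nu) L) *: mu ^+ size L.

(* Moments of mu_1 . beta . nu_1 + ... + mu_n . beta . nu_n: the summands are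
   multiplied out as uncorrelated in K[A], and E is applied last, because the
   mu_j may share umbrae. *)
Definition aux_moment (K : numFieldType) (A : choiceType)
    (E : {scalar upoly K A}) (n m : nat) (mu : 'I_n -> upoly K A)
    (nu : 'I_n -> 'I_m -> upoly K A) (i : 'X_{1..m}) : K :=
  E (\sum_(k : {ffun 'I_n -> 'X_{1..m < (mdeg i).+1}} |
           (\sum_(j < n) (k j : 'X_{1..m}))%MM == i)
       ((mfact i)%:R / (\prod_(j < n) mfact (k j))%:R)
         *: \prod_(j < n) bell_dot_power E (mu j) (nu j) (k j)).

Definition aux_gf (K : numFieldType) (A : choiceType)
    (E : {scalar upoly K A}) (n m : nat) (mu : 'I_n -> upoly K A)
    (nu : 'I_n -> 'I_m -> upoly K A) : fps K m :=
  fun i => aux_moment E mu nu i / (mfact i)%:R.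

Lemma mem_partitions (m : nat) (i : 'X_{1..m}) (L : seq 'X_{1..m}) :
  (L \in partitions i) = is_partition i L.
Proof.
rewrite mem_filter; case: (boolP (is_partition i L)) => //= /and3P[L0 _ /eqP Li].
have degL (s : seq 'X_{1..m}) : mdeg (\sum_(c <- s) c)%MM = (\sum_(c <- s) mdeg c)%N.
  by elim: s => [|c s IH]; rewrite ?big_nil ?mdeg0 // !big_cons mdegD IH.
have szL : (size L <= mdeg i)%N.
  rewrite -Li degL -sum1_size big_seq [X in (_ <= X)%N]big_seq; apply: leq_sum => c cL.
  by rewrite lt0n mdeg_eq0; apply: contraNneq L0 => <-.
have ltL c : c \in L -> (mdeg c < (mdeg i).+1)%N.
  by move=> cL; rewrite ltnS -Li degL (big_rem c) //= leq_addr.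
pose B := pmap (insub : _ -> option 'X_{1..m < (mdeg i).+1}) L.
have BL : map val B = L.
  rewrite (pmap_filter (insubK _)); apply/all_filterP/allP => c /ltL lt_c.
  by rewrite isSome_insub.
have szB : (size B <= mdeg i)%N by rewrite -(size_map val) BL.
by apply/mapP; exists (Bseq szB); rewrite ?mem_enum ?BL.
Qed.

Lemma partitions_uniq (m : nat) (i : 'X_{1..m}) : uniq (partitions i).
Proof.
apply/filter_uniq; rewrite map_inj_uniq ?enum_uniq // => B1 B2.
by move/(inj_map val_inj)/val_inj.
Qed.

Lemma gf_sub1_const (K : numFieldType) (A : choiceType)
    (E : {scalar upoly K A}) (k : nat) (mu : 'I_k -> upoly K A) :
  fps_sub (gf E mu) (@fps_one K k) 0%MM = 0.
Proof. by rewrite /fps_sub /gf /fps_one eqxx subrr. Qed.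

Lemma fps_mul_order (K : numFieldType) (m : nat) (s t : fps K m) (a b : nat) :
  (forall i, (mdeg i < a)%N -> s i = 0) ->
  (forall i, (mdeg i < b)%N -> t i = 0) ->
  forall i, (mdeg i < a + b)%N -> fps_mul s t i = 0.
Proof.
move=> sa tb i; rewrite /fps_mul => lt_i; apply: big1 => k /eqP ki.
have lt_k : (mdeg k.1 + mdeg k.2 < a + b)%N by rewrite -mdegD ki.
have [lt_a|le_a] := ltnP (mdeg k.1) a; first by rewrite sa // mul0r.
rewrite tb ?mulr0 // -(ltn_add2l (mdeg k.1)).
by apply: leq_trans lt_k _; rewrite leq_add2r.
Qed.

Lemma fps_tuple_exp_eq0 (K : numFieldType) (n m : nat) (s : 'I_n -> fps K m)
    (k : 'X_{1..n}) (i : 'X_{1..m}) :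
  (forall j, s j 0%MM = 0) -> (mdeg i < mdeg k)%N -> fps_tuple_exp s k i = 0.
Proof.
move=> s0; rewrite (mdegE k) /fps_tuple_exp.
have exp_order j e l : (mdeg l < e)%N -> fps_exp (s j) e l = 0.
  elim: e l => [//|e IH] l lt_l.
  apply: (@fps_mul_order _ _ _ _ 1 e) => // l'.
  by rewrite ltnS leqn0 mdeg_eq0 => /eqP->.
elim: (index_enum _) i => [|j r IH] i; first by rewrite big_nil.
rewrite !big_cons.
by apply: fps_mul_order => // l; apply: exp_order.
Qed.

(* Main.v *)
(* With g_j = f(nu_j, t) - 1, the coefficient of g_j^e / e! at t^k is the sum,
   over the partitions of k into e columns, of prod_c g_j(c)^r_c / r_c!. Hence
   (mu_j . beta . nu_j)^k = k! sum_e (g_j^e / e!)_k mu_j^e is the coefficient of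
   exp(mu_j g_j), up to the factor k!. Multiplying over j and distributing,
   E acts on each monomial mu^e, which leaves sum_e E[mu^e]/e! g^e.

   The partition identity is proved by recursion on e, without counting the
   orderings of a partition: removing a column c maps the partitions of c + k
   containing c bijectively onto the partitions of k. *)
Require Import Defs.
From HB Require Import structures.
From mathcomp Require Import all_boot all_order all_algebra.
From mathcomp Require Import finmap monalg mpoly complex reals.
Import Order.TTheory GRing.Theory Num.Theory.
Local Open Scope ring_scope.

(** The share of the partition [L] in g^e / e! with e = [size L]: its e! / prod_c r_c! orderings,
    divided by e!. *)
Definition part_weight {K : numFieldType} {m : nat} (g : fps K m)
    (L : seq 'X_{1..m}) : K :=
  \prod_(c <- undup L) (g c ^+ count_mem c L / ((count_mem c L)`!)%:R).

(** Only the factor of [c] changes, by r g^r / r! = g * g^(r-1) / (r-1)!. *)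
Lemma part_weight_rem {K : numFieldType} {m : nat} (g : fps K m)
    (L : seq 'X_{1..m}) (c : 'X_{1..m}) :
  c \in L ->
  (count_mem c L)%:R * part_weight g L = g c * part_weight g (rem c L).
Proof.
move=> cL; have cU : c \in undup L by rewrite mem_undup.
have permL := perm_to_rem cL.
have countL d : count_mem d L = ((c == d) + count_mem d (rem c L))%N.
  by rewrite (permP permL).
(* If [c] occurs once in [L], it is absent from [rem c L]; the extra factor is then g^0 / 0! = 1, so
   both weights range over the same columns. *)
have -> : part_weight g (rem c L) = \prod_(d <- undup L)
    (g d ^+ count_mem d (rem c L) / ((count_mem d (rem c L))`!)%:R).
  rewrite /part_weight [RHS](bigID (mem (undup (rem c L)))) /=.
  rewrite [X in _ * X]big1 => [|d]; last first.
    by rewrite mem_undup => /count_memPn ->; rewrite expr0 divr1.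
  rewrite mulr1 -[RHS]big_filter; apply: perm_big; apply: uniq_perm.
  - exact: undup_uniq.
  - exact/filter_uniq/undup_uniq.
  move=> d; rewrite mem_filter !mem_undup andb_idr //.
  by rewrite (perm_mem permL) inE => ->; rewrite orbT.
rewrite /part_weight !(bigD1_seq c cU (undup_uniq L)) /= !mulrA.
congr (_ * _); last first.
  by apply: eq_bigr => d dc; rewrite countL eq_sym (negPf dc).
by rewrite countL eqxx add1n factS natrM exprS invfM mulrACA divff ?mul1r ?pnatr_eq0.
Qed.

(** Splits the factor [size L] into multiplicities, to each of which [part_weight_rem] applies. *)
Lemma size_count_bmultinom {m d : nat} (L : seq 'X_{1..m}) :
  (forall c, c \in L -> (mdeg c < d)%N) ->
  size L = (\sum_(c : 'X_{1..m < d}) count_mem (val c) L)%N.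
Proof.
move=> ltL; under eq_bigr do rewrite -sum1_count big_mkcond.
rewrite exchange_big /= -sum1_size big_seq [RHS]big_seq.
apply: eq_bigr => c /ltL lt_c; rewrite (bigD1 (BMultinom lt_c)) //= eqxx.
rewrite big1 // => b; rewrite -val_eqE /= eq_sym.
by case: eqP.
Qed.

Lemma mlex_le_trans m : transitive (@mlex_le m).
Proof. by move=> b a c; apply: le_trans. Qed.

Lemma mlex_le_total m : total (@mlex_le m).
Proof. by move=> a b; apply: le_total. Qed.

Lemma mlex_le_anti m : antisymmetric (@mlex_le m).
Proof. by move=> a b /le_anti /val_inj. Qed.

(** The inverse map inserts [c] and sorts. Both composites are identities because a sorted list is
    determined by its multiset of columns. *)
Lemma perm_partitions_rem {m : nat} (c k : 'X_{1..m}) :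
  c != 0%MM ->
  perm_eq [seq rem c L | L <- partitions (c + k)%MM & c \in L] (partitions k).
Proof.
move=> c0; apply: uniq_perm (partitions_uniq _) _.
  rewrite map_inj_in_uniq; first exact/filter_uniq/partitions_uniq.
  move=> L1 L2.
  rewrite !(mem_filter (fun L : seq _ => c \in L)) !mem_partitions.
  move=> /andP[cL1 /and3P[_ sL1 _]] /andP[cL2 /and3P[_ sL2 _]] eqr.
  apply: (sorted_eq (@mlex_le_trans m) (@mlex_le_anti m)) => //.
  rewrite (perm_trans (perm_to_rem cL1)) // eqr perm_sym.
  exact: perm_to_rem.
move=> L; rewrite mem_partitions; apply/mapP/idP => [[L1]|].
  rewrite mem_filter mem_partitions => /andP[cL1 /and3P[nz sL1 /eqP sumL1]] ->.
  apply/and3P; split.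
  - by apply: contra nz; apply: mem_rem.
  - exact: (subseq_sorted (@mlex_le_trans m) (rem_subseq c L1) sL1).
  move: sumL1; rewrite (perm_big _ (perm_to_rem cL1)) big_cons /= => sumL1.
  by rewrite -(addmK c k) [(k + c)%MM]addmC -sumL1 addmC addmK.
case/and3P=> nz sL /eqP sumL.
have permL : perm_eq (sort (@mlex_le m) (c :: L)) (c :: L) by rewrite perm_sort.
have cS : c \in sort (@mlex_le m) (c :: L) by rewrite mem_sort inE eqxx.
exists (sort (@mlex_le m) (c :: L)).
  rewrite mem_filter cS mem_partitions /=; apply/and3P; split.
  - by rewrite mem_sort inE negb_or eq_sym c0.
  - exact/sort_sorted/mlex_le_total.
  by rewrite (perm_big _ permL) big_cons sumL.
apply: (sorted_eq (@mlex_le_trans m) (@mlex_le_anti m)) => //.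
  apply: (subseq_sorted (@mlex_le_trans m) (rem_subseq c _)).
  exact/sort_sorted/mlex_le_total.
rewrite -(perm_cons c) perm_sym.
by rewrite (perm_trans _ permL) // perm_sym perm_to_rem.
Qed.

Lemma partition_mem_addm {m : nat} (k c : 'X_{1..m}) (L : seq 'X_{1..m}) :
  L \in partitions k -> c \in L -> exists k', k = (c + k')%MM.
Proof.
rewrite mem_partitions => /and3P[_ _ /eqP <-] cL.
by rewrite (perm_big _ (perm_to_rem cL)) big_cons; eexists.
Qed.

(** The outer sum has at most one term, k' = k - c; if there is none, no partition of [k] contains
    [c]. *)
Lemma big_partitions_rem {R : nmodType} {m d : nat} (c k : 'X_{1..m})
    (F : seq 'X_{1..m} -> R) :
  c != 0%MM -> (mdeg k < d)%N ->
  \sum_(k' : 'X_{1..m < d} | (c + k')%MM == k) \sum_(L <- partitions k') F L =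
  \sum_(L <- partitions k | c \in L) F (rem c L).
Proof.
move=> c0 lt_k.
(* Subtraction of multi-indices is truncated, so this equation tests whether c <= k entrywise. *)
have [/eqP kE|nle] := boolP (c + (k - c) == k)%MM.
  have lt_k' : (mdeg (k - c)%MM < d)%N by apply: leq_ltn_trans (mdegB _ _) lt_k.
  rewrite (big_pred1 (BMultinom lt_k')) /= => [|b].
    rewrite -(perm_big _ (perm_partitions_rem c (k - c)%MM c0)) kE /=.
    by rewrite big_map big_filter.
  apply/eqP/eqP => [bk|->] //; apply: val_inj => /=.
  by rewrite -bk addmC addmK.
have subK k' : k = (c + k')%MM -> False.
  by move=> kE; case/eqP: nle; rewrite {1}kE addmC kE [(c + k')%MM]addmC addmK.
rewrite big1 => [|k' /eqP/esym/subK //].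
rewrite big1_seq // => L /andP[cL Lk].
by case: (partition_mem_addm _ _ _ Lk cL) => k' /subK.
Qed.

(** Induction on [e] along g^(e+1) = g * g^e: the factor e + 1 of (e+1)! is the number of columns,
    and each column value [c] taken out leaves a partition of k - c into [e] columns. *)
Lemma sum_part_weight {K : numFieldType} {m : nat} (g : fps K m) (e : nat)
    (k : 'X_{1..m}) :
  g 0%MM = 0 ->
  (e`!)%:R * (\sum_(L <- partitions k | size L == e) part_weight g L) =
  fps_exp g e k.
Proof.
move=> g0; elim: e k => [|e IH] k.
  rewrite mul1r /fps_exp /= /fps_one.
  under eq_bigl do rewrite size_eq0.
  have nilP : ([::] \in partitions k) = (k == 0%MM).
    by rewrite mem_partitions /is_partition big_nil eq_sym.
  case: eqP nilP => [_|_] nilk.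
    rewrite -big_filter (perm_big [:: [::]]) ?big_seq1 /part_weight ?big_nil //.
    apply: uniq_perm => [||L] //; first exact/filter_uniq/partitions_uniq.
    by rewrite mem_filter inE andb_idr // => /eqP->.
  by rewrite big1_seq // => L /andP[/eqP->]; rewrite nilk.
(* This is the bound used in [fps_mul]; it also exceeds the degree of every column of a partition of
   [k]. *)
set d := (mdeg k).+1.
have stepL L : L \in partitions k ->
    (size L)%:R * part_weight g L =
    \sum_(c : 'X_{1..m < d} | val c \in L) g (val c) * part_weight g (rem (val c) L).
  move=> Lk; rewrite (@size_count_bmultinom m d) => [|c cL]; last first.
    by case: (partition_mem_addm _ _ _ Lk cL) => k' kE; rewrite /d kE mdegD ltnS leq_addr.
  rewrite natr_sum mulr_suml [RHS]big_mkcond; apply: eq_bigr => c _.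
  case: ifP => [cL|/negbT/count_memPn ->]; first exact: part_weight_rem.
  by rewrite mul0r.
rewrite factS mulnC natrM -mulrA mulr_sumr.
rewrite big_seq_cond (eq_bigr (fun L => \sum_(c : 'X_{1..m < d} | val c \in L)
  g (val c) * part_weight g (rem (val c) L))); last first.
  by move=> L /andP[Lk /eqP <-]; apply: stepL.
rewrite -big_seq_cond.
rewrite (exchange_big_dep predT) //= mulr_sumr.
rewrite -[RHS]/(fps_mul g (fps_exp g e) k) /fps_mul -/d.
rewrite -(pair_big_dep predT (fun c k' : 'X_{1..m < d} => (c + k')%MM == k)
  (fun c k' => g (val c) * fps_exp g e (val k'))) /=.
apply: eq_bigr => c _.
have [c0|c0] := eqVneq (val c) 0%MM.
  by rewrite !c0 g0 big1 ?mulr0 ?big1 // => *; rewrite mul0r.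
under [RHS]eq_bigr do rewrite -IH.
rewrite -!mulr_sumr mulrCA; congr (_ * (_ * _)).
under [RHS]eq_bigr do rewrite big_mkcond.
rewrite (big_partitions_rem (val c) k
  (fun L => if size L == e then part_weight g L else 0) c0) //.
rewrite -big_mkcondr big_seq_cond [RHS]big_seq_cond; apply: eq_bigl => L /=.
case: (boolP (L \in _)) => //= _; rewrite andbC; apply: andb_id2l => cL.
by rewrite size_rem //; case: (L) cL.
Qed.

(* Up to degree d, series multiply as their truncations in K[t_1, ..., t_m]. *)
Lemma fps_big_mulE {K : numFieldType} {n m : nat} (s : 'I_n -> fps K m)
    (d : nat) (i : 'X_{1..m}) :
  (mdeg i < d)%N ->
  (\big[@fps_mul K m/@fps_one K m]_(j < n) s j) i =
  \sum_(k : {ffun 'I_n -> 'X_{1..m < d}} |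
         (\sum_(j < n) (k j : 'X_{1..m}))%MM == i) \prod_(j < n) s j (k j).
Proof.
move=> lt_i; pose p j : mpoly m K := \sum_(k : 'X_{1..m < d}) s j k *: 'X_[k].
have : forall i, (mdeg i < d)%N ->
    (\big[@fps_mul K m/@fps_one K m]_(j < n) s j) i = (\prod_(j < n) p j)@_i.
  apply: (big_rec2 (fun (f : fps K m) (q : mpoly m K) =>
      forall i, (mdeg i < d)%N -> f i = q@_i)) => [i1 _|j q f _ IH i1 lt_i1].
    by rewrite mcoeff1.
  rewrite mcoeffM; under [RHS]eq_bigl do rewrite eq_sym.
  apply: eq_bigr => k /eqP kE.
  have /andP[lt1 lt2] : (mdeg k.1 < d)%N && (mdeg k.2 < d)%N.
    by rewrite -kE mdegD in lt_i1; rewrite !(leq_ltn_trans _ lt_i1) ?leq_addl ?leq_addr.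
  by rewrite IH // /p mcoeff_mpoly.
(* Each choice of one term per factor yields a monomial with exponent sum_j k_j, which counts only
   when this is [i]. *)
move=> ->//; rewrite bigA_distr_bigA /= raddf_sum [RHS]big_mkcond /=.
apply: eq_bigr => k _; rewrite scaler_prod.
rewrite -(big_morph _ (@mpolyXD m K) (@mpolyX0 m K)) mcoeffZ mcoeffX.
by case: eqP => _; rewrite ?mulr1 ?mulr0.
Qed.

(** Trades the bound on total degree for a bound on each exponent, so that the index set becomes a
    product, as distributivity requires. *)
Lemma big_bmultinom_ffun {R : nmodType} {n d : nat} (F : 'X_{1..n} -> R) :
  (forall e, (d < mdeg e)%N -> F e = 0) ->
  \sum_(e : 'X_{1..n < d.+1}) F e =
  \sum_(e : {ffun 'I_n -> 'I_d.+1}) F [multinom (e j : nat) | j < n].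
Proof.
move=> F0; pose mn (e : {ffun 'I_n -> 'I_d.+1}) := [multinom (e j : nat) | j < n].
pose toffun (b : 'X_{1..n < d.+1}) : {ffun 'I_n -> 'I_d.+1} :=
  [ffun j => inord (b j)].
(* A default value for [insubd], never reached on the exponents of degree at most [d]. *)
have b0 : 'X_{1..n < d.+1} by exists 0%MM; rewrite mdeg0.
have mnK (b : 'X_{1..n < d.+1}) : mn (toffun b) = b.
  apply/mnmP => j; rewrite mnmE ffunE inordK //.
  by apply: leq_ltn_trans (bmdeg b); rewrite mdegE (bigD1 j) //= leq_addr.
rewrite [RHS](bigID (fun e => mdeg (mn e) < d.+1)%N) /=.
rewrite [X in _ + X]big1 ?addr0; last first.
  by move=> e; rewrite -leqNgt => /F0.
rewrite (reindex_onto toffun (fun e => insubd b0 (mn e))) /= => [|e lt_e].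
  apply: esym; apply: eq_big => [b|b _]; last exact: (congr1 F (mnK b)).
  by rewrite mnK bmdeg valKd eqxx.
by apply/ffunP => j; rewrite ffunE insubdK // mnmE inord_val.
Qed.

Lemma part_weight_gf {K : numFieldType} {A : choiceType}
    (E : {scalar upoly K A}) {m : nat} (nu : 'I_m -> upoly K A)
    (L : seq 'X_{1..m}) :
  0%MM \notin L ->
  part_moment (moment E nu) L / (part_mult_fact L * part_fact L)%:R =
  part_weight (fps_sub (gf E nu) (@fps_one K m)) L.
Proof.
move=> L0; rewrite /part_moment /part_mult_fact /part_fact -big_split /=.
rewrite natr_prod -prodfV -big_split /= /part_weight [LHS]big_seq [RHS]big_seq.
apply: eq_bigr => c; rewrite mem_undup => cL.
have c0 : c == 0%MM = false by apply: contraNF L0 => /eqP <-.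
rewrite /fps_sub /gf /fps_one c0 subr0 natrM natrX exprMn exprVn invfM.
by rewrite mulrCA mulrC mulrAC.
Qed.

(** Groups the partitions by their number of columns, which is at most |k| and hence below [d]. *)
Lemma bell_dot_powerE {K : numFieldType} {A : choiceType}
    (E : {scalar upoly K A}) {m d : nat} (mu : upoly K A)
    (nu : 'I_m -> upoly K A) (k : 'X_{1..m}) :
  (mdeg k < d)%N ->
  bell_dot_power E mu nu k =
  \sum_(e < d) ((mfact k)%:R *
    fps_exp (fps_sub (gf E nu) (@fps_one K m)) e k / (e`!)%:R) *: mu ^+ e.
Proof.
move=> lt_k; rewrite /bell_dot_power; set g := fps_sub _ _.
transitivity (\sum_(L <- partitions k) \sum_(e < d | size L == e)
    ((mfact k)%:R * part_weight g L) *: mu ^+ e).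
  rewrite [LHS]big_seq [RHS]big_seq; apply: eq_bigr => L.
  rewrite mem_partitions => /and3P[L0 _ /eqP sumL].
  have lt_L : (size L < d)%N.
    apply: leq_ltn_trans lt_k; rewrite -sumL mdeg_sum -sum1_size.
    rewrite big_seq [leqRHS]big_seq; apply: leq_sum => c cL.
    by rewrite lt0n mdeg_eq0; apply: contraNneq L0 => <-.
  rewrite (big_pred1 (Ordinal lt_L)) /=.
    by rewrite -(part_weight_gf E nu L L0) mulrA mulrAC.
  by move=> e; apply: eq_sym.
rewrite (exchange_big_dep predT) //=; apply: eq_bigr => e _.
rewrite -(scaler_suml _ _ _ (fun L => (mfact k)%:R * part_weight g L)).
rewrite -mulr_sumr; apply: (congr1 (fun x => x *: mu ^+ e)).
rewrite -(sum_part_weight g e k (gf_sub1_const E nu)).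
by rewrite -mulrA [_`!%:R * _]mulrC mulfK // pnatr_eq0 -lt0n fact_gt0.
Qed.

Theorem theorem3p5 (K : numFieldType) (hK : real_or_complex K) (A : choiceType)
    (E : {scalar upoly K A}) (hE : is_evaluation E) (n m : nat)
    (mu : 'I_n -> upoly K A) (hmu : forall j : 'I_n, umbral_monomial (mu j))
    (nu : 'I_n -> 'I_m -> upoly K A)
    (hnu : forall (j : 'I_n) (r : 'I_m), umbral_monomial (nu j r)) :
  aux_gf E mu nu =1
    fps_subst (gf E mu) (fun j : 'I_n => fps_sub (gf E (nu j)) (@fps_one K m)).
Proof.
move=> i; set g := fun j => _.
(* The constant term, set to 1 in [gf], agrees with the general formula because E[1] = 1. *)
have gfE e : gf E mu e = moment E mu e / (mfact e)%:R.
  rewrite /gf; case: eqP => // ->.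
  rewrite /moment /tuple_exp /mfact !big1 => [|j _|j _]; rewrite ?mnmE ?expr0 //.
  by rewrite hE.1 divr1.
have mfact_neq0 p (k : 'X_{1..p}) : (mfact k)%:R != 0 :> K.
  rewrite /mfact natr_prod; apply/prodf_neq0 => r _.
  by rewrite pnatr_eq0 -lt0n fact_gt0.
rewrite /fps_subst (@big_bmultinom_ffun _ _ _
    (fun e => gf E mu e * fps_tuple_exp g e i)) => [|e lt_e]; last first.
  rewrite fps_tuple_exp_eq0 ?mulr0 // => j; exact: gf_sub1_const.
under [RHS]eq_bigr => e _.
  rewrite /fps_tuple_exp (@fps_big_mulE _ _ _ _ (mdeg i).+1) // mulr_sumr.
  over.
(* Both sides are now sums over the same decompositions k_1 + ... + k_n = i, compared term by
   term. *)
rewrite exchange_big /= /aux_gf /aux_moment linear_sum /= mulr_suml.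
apply: eq_bigr => k _.
under [X in _ *: X]eq_bigr do rewrite (bell_dot_powerE E _ _ _ (bmdeg _)).
(* Only after distributing does [E] act, on whole monomials in the mu_j, so no factorization of [E]
   over them is used. *)
rewrite bigA_distr_bigA linearZ linear_sum /= mulrAC.
rewrite [_ / _ / _]mulrAC divff // mul1r mulr_sumr; apply: eq_bigr => e _.
rewrite scaler_prod linearZ /= gfE -!mulrA.
have -> : \prod_(j < n) mu j ^+ e j = tuple_exp mu [multinom (e j : nat) | j < n].
  by apply: eq_bigr => j _; rewrite mnmE.
rewrite -/(moment E mu _) [RHS]mulrC mulrA; congr (_ * _).
(* What remains is, for each [j], the cancellation of k_j! against the factor introduced by
   [bell_dot_powerE]. *)
rewrite /mfact !natr_prod -!prodfV -!big_split /=; apply: eq_bigr => j _.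
by rewrite !mnmE -mulrA mulKf ?mfact_neq0 // mulrC.
Qed.
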